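(* Let $\alpha : I\to E^3$ be a unit speed curve with tangent $T$, binormal $B$, curvature $\kappa$ and torsion $\tau$, let $a,b,c,d$ be real constants, and let $\Phi$ be the ruled surface with base curve $\alpha$ $$\Phi : I\times\mathbb{R}\to E^3,\qquad \Phi(s,v)=\alpha(s)+v\,[(as+b)T(s)+(cs+d)B(s)].$$ Then $\Phi$ is developable if and only if $\alpha$ is a generalized Euler spiral which has the property $$\frac{\kappa}{\tau}=\frac{cs+d}{as+b}.$$
   Context: $I\subset\mathbb{R}$ is an interval and $s$ is the arc length parameter of $\alpha$; curves are smooth in Euclidean 3-space $E^3$, with Frenet frame $T,N,B$ (unit tangent, principal normal, binormal), $\kappa>0$ and Frenet equations $T'=\kappa N$, $N'=-\kappa T+\tau B$, $B'=-\tau N$. A generalized Euler spiral in $E^3$ is a curve for which $\kappa/\tau=(ps+q)/(rs+t)$ for some real constants $p,q,r,t$. A ruled surface $\alpha(s)+vX(s)$ is developable if and only if $\det(\alpha'(s),X(s),X'(s))=0$ for all $s$.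
   Formalization: Assumes (c,d)≠(0,0): for c=d=0 the surface is always developable but κ/τ=0 contradicts κ>0. Also assumes (a,b)≠(0,0), so that the quotient is defined, and reads the ratio equation (with τ≠0) at the points of I where as+b≠0. *)

(* Defs.v *)
From HB Require Import structures.
From mathcomp Require Import all_boot all_order all_algebra.
From mathcomp Require Import all_classical all_reals all_analysis.

Set Implicit Arguments.
Unset Strict Implicit.
Unset Printing Implicit Defensive.

Import Order.TTheory GRing.Theory Num.Theory.
Import numFieldNormedType.Exports.

Local Open Scope classical_set_scope.
Local Open Scope ring_scope.

(* The norm that the library puts on 'rV[R]_3 is the sup norm; it is used here
   only for limits and derivatives, while lengths are measured by [enorm]. *)
Definition dotv (R : realType) (u v : 'rV[R]_3) : R :=
  \sum_(i < 3) u 0 i * v 0 i.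

Definition enorm (R : realType) (u : 'rV[R]_3) : R := Num.sqrt (dotv u u).

(* Component i is u_(i+1) v_(i+2) - u_(i+2) v_(i+1), indices modulo 3. *)
Definition crossv (R : realType) (u v : 'rV[R]_3) : 'rV[R]_3 :=
  \row_(i < 3) (u 0 (i + 1) * v 0 (i + 2%:R) - u 0 (i + 2%:R) * v 0 (i + 1)).

Definition det3 (R : realType) (u v w : 'rV[R]_3) : R :=
  \det (\matrix_(i < 3, j < 3) (tnth [tuple u; v; w] i) 0 j).

(* On an interval containing an endpoint, smoothness means that the curve is
   C^oo on some open set containing the interval.  The interval being
   nondegenerate, derivatives at such an endpoint are determined by the
   restriction of the curve to the interval. *)
Definition smooth_on (R : realType) (I : set R) (alpha : R -> 'rV[R]_3) :=
  exists U : set R, [/\ open U, I `<=` U &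
    forall (n : nat) (s : R), U s -> derivable (derive1n n alpha) s 1].

Definition unit_speed (R : realType) (I : set R) (alpha : R -> 'rV[R]_3) :=
  forall s, I s -> enorm (derive1 alpha s) = 1.

(* Frenet apparatus of a unit speed curve. *)
Definition tangent (R : realType) (alpha : R -> 'rV[R]_3) : R -> 'rV[R]_3 :=
  derive1 alpha.

Definition curvature (R : realType) (alpha : R -> 'rV[R]_3) (s : R) : R :=
  enorm (derive1 (tangent alpha) s).

Definition normal (R : realType) (alpha : R -> 'rV[R]_3) (s : R) : 'rV[R]_3 :=
  (curvature alpha s)^-1 *: derive1 (tangent alpha) s.

Definition binormal (R : realType) (alpha : R -> 'rV[R]_3) (s : R) :
    'rV[R]_3 :=
  crossv (tangent alpha s) (normal alpha s).

(* Sign convention B' = - tau N. *)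
Definition torsion (R : realType) (alpha : R -> 'rV[R]_3) (s : R) : R :=
  - dotv (derive1 (binormal alpha) s) (normal alpha s).

(* kappa / tau = (p s + q) / (r s + t) on I, as an equality of quotients of
   functions: the denominator r s + t is not the zero polynomial, and wherever
   it does not vanish on I the quotient kappa / tau is defined too and the two
   quotients agree. *)
Definition curvature_torsion_ratio (R : realType) (I : set R)
    (alpha : R -> 'rV[R]_3) (p q r t : R) : Prop :=
  (r != 0 \/ t != 0) /\
  forall s, I s -> r * s + t != 0 ->
    torsion alpha s != 0 /\
    curvature alpha s / torsion alpha s = (p * s + q) / (r * s + t).

Definition generalized_euler_spiral (R : realType) (I : set R)
    (alpha : R -> 'rV[R]_3) : Prop :=
  exists p q r t : R, curvature_torsion_ratio I alpha p q r t.

Record ruled_surface (R : realType) := RuledSurface {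
  base_curve : R -> 'rV[R]_3 ;
  director : R -> 'rV[R]_3
}.

Definition ruled_map (R : realType) (Phi : ruled_surface R) (s v : R) :
    'rV[R]_3 :=
  base_curve Phi s + v *: director Phi s.

Coercion ruled_map : ruled_surface >-> Funclass.

Definition developable (R : realType) (I : set R) (Phi : ruled_surface R) :=
  forall s, I s ->
    det3 (derive1 (base_curve Phi) s) (director Phi s)
      (derive1 (director Phi) s) = 0.

(* Main.v *)
Require Import Defs.
From HB Require Import structures.
From mathcomp Require Import all_boot all_order all_algebra.
From mathcomp Require Import all_classical all_reals all_analysis.
From mathcomp Require Import ring lra.

Import Order.TTheory GRing.Theory Num.Theory.
Import numFieldNormedType.Exports.

Set Implicit Arguments.
Unset Strict Implicit.
Unset Printing Implicit Defensive.

Local Open Scope classical_set_scope.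
Local Open Scope ring_scope.

(** Write f = as + b and g = cs + d, and let X = f T + g B be the director.  As
    T' = kappa N and the normal component of B' is - tau,
    - the cross product of T and X is - g N, and
    - the normal component of X' is f kappa - g tau,
    so that det(T, X, X') = - g D with D = f kappa - g tau ([det3_ruling]).
    Hence the surface is developable iff g D vanishes on I.  On the other hand
    clearing denominators shows that kappa / tau = g / f holds wherever f does
    not vanish iff f D vanishes on I; tau is then automatically nonzero there,
    because g tau = f kappa is nonzero.

    Both conditions are equivalent to D = 0 on I.  Indeed f and g are nonzero
    affine functions, so each has at most one zero; off that zero D vanishes,
    and at that zero it vanishes too because D is continuous and I has no
    isolated point ([affine_mul_eq0]).

    What needs care is that derivatives are two-sided while the hypotheses
    (unit speed, positive curvature) concern I only, which may contain its
    endpoints.  For instance T . T' = 0 at an endpoint cannot be obtained by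
    differentiating the identity T . T = 1 on a neighbourhood.  It holds because
    the two-sided derivative, which exists by smoothness, is already determined
    by the values along I ([limit_point_derive_eq0]).  For the
    continuity of D, the torsion is replaced by an explicit continuous
    expression in the first three derivatives of the curve which coincides with
    it on I ([torsionE]). *)

(** * Dot and cross products in coordinates *)

Section VectorAlgebra.
Variable R : realType.
Implicit Types (u v w : 'rV[R]_3) (k : R).

Lemma ord3_ind (P : 'I_3 -> Prop) : P 0 -> P 1 -> P 2%:R -> forall i, P i.
Proof.
move=> P0 P1 P2 [[|[|[|//]]] lt_i3].
- by rewrite (_ : Ordinal _ = 0) //; apply/val_inj.
- by rewrite (_ : Ordinal _ = 1) //; apply/val_inj.
- by rewrite (_ : Ordinal _ = 2%:R) //; apply/val_inj.
Qed.

Lemma dotvE u v :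
  dotv u v = u 0 0 * v 0 0 + u 0 1 * v 0 1 + u 0 2%:R * v 0 2%:R.
Proof.
rewrite /dotv !big_ord_recl big_ord0 addr0 addrA.
by congr (_ * _ + _ * _ + _ * _); congr (_ 0 _); apply/val_inj.
Qed.

Lemma crossvE u v :
  [/\ crossv u v 0 0 = u 0 1 * v 0 2%:R - u 0 2%:R * v 0 1,
      crossv u v 0 1 = u 0 2%:R * v 0 0 - u 0 0 * v 0 2%:R &
      crossv u v 0 2%:R = u 0 0 * v 0 1 - u 0 1 * v 0 0].
Proof.
by split; rewrite mxE; congr (_ * _ - _ * _); congr (_ 0 _); apply/val_inj.
Qed.

Lemma det3E u v w : det3 u v w = dotv (crossv u v) w.
Proof.
rewrite /det3 (expand_det_row _ ord0) !big_ord_recl big_ord0 /cofactor.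
rewrite !(expand_det_row _ ord0) !big_ord_recl !big_ord0 /cofactor.
rewrite !det_mx11 !mxE /= !(tnth_nth 0) /=.
rewrite dotvE; have [-> -> ->] := crossvE u v.
(* Indexing coordinates by nat lets the compositions of lifts produced by the
   Laplace expansion compute to 0, 1 and 2. *)
pose coord (x : 'rV[R]_3) n : R := x 0 (inord n).
have coordE (x : 'rV[R]_3) i : x 0 i = coord x i by rewrite /coord inord_val.
by rewrite !coordE /bump /=; ring.
Qed.

Lemma crossvv u : crossv u u = 0.
Proof.
apply/rowP; have [c0 c1 c2] := crossvE u u.
by elim/ord3_ind; rewrite ?c0 ?c1 ?c2 mxE mulrC subrr.
Qed.

Lemma crossvDr u v w : crossv u (v + w) = crossv u v + crossv u w.
Proof. by apply/rowP => i; rewrite !mxE; ring. Qed.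

Lemma crossvZr u v k : crossv u (k *: v) = k *: crossv u v.
Proof. by apply/rowP => i; rewrite !mxE; ring. Qed.

Lemma dotvC u v : dotv u v = dotv v u.
Proof. by apply: eq_bigr => i _; rewrite mulrC. Qed.

Lemma dotvDr u v w : dotv u (v + w) = dotv u v + dotv u w.
Proof. by rewrite -big_split; apply: eq_bigr => i _; rewrite mxE mulrDr. Qed.

Lemma dotvZr u v k : dotv u (k *: v) = k * dotv u v.
Proof. by rewrite mulr_sumr; apply: eq_bigr => i _; rewrite mxE mulrCA. Qed.

Lemma dotvZl u v k : dotv (k *: u) v = k * dotv u v.
Proof. by rewrite dotvC dotvZr dotvC. Qed.

Lemma dotv_crossv u v : dotv (crossv u v) v = 0.
Proof. by rewrite dotvE; have [-> -> ->] := crossvE u v; ring. Qed.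

Lemma dotv_crossvCA u v w : dotv (crossv u v) w = - dotv (crossv u w) v.
Proof.
rewrite !dotvE; have [-> -> ->] := crossvE u v.
by have [-> -> ->] := crossvE u w; ring.
Qed.

Lemma crossv_crossv u v : crossv u (crossv u v) = dotv u v *: u - dotv u u *: v.
Proof.
apply/rowP; have [c0 c1 c2] := crossvE u (crossv u v).
have [d0 d1 d2] := crossvE u v.
by elim/ord3_ind; rewrite ?c0 ?c1 ?c2 ?d0 ?d1 ?d2 !mxE !dotvE; ring.
Qed.

Lemma enorm_sqr u : enorm u ^+ 2 = dotv u u.
Proof. by rewrite sqr_sqrtr // sumr_ge0 // => i _; rewrite -expr2 sqr_ge0. Qed.

End VectorAlgebra.

(** * Limits along a set and derivatives of vector functions *)

Section Calculus.
Variable R : realType.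
Implicit Types (I : set R) (s : R).

(** A nondegenerate interval contains some z other than s, hence the points
    s + t (z - s) for small positive t, which tend to s. *)
Lemma interval_limit_point I s :
  is_interval I -> I° !=set0 -> I s -> limit_point I s.
Proof.
move=> itvI [x Ix] Is.
have [z Iz zs] : exists2 z, I z & z != s.
  have [xs|xs] := eqVneq x s; last by exists x => //; exact: nbhs_singleton.
  move: Ix; rewrite xs => -[e /= e0 eI]; exists (s + e / 2).
    apply: eI; rewrite /ball_/= opprD addNKr normrN gtr0_norm ?divr_gt0 //.
    by rewrite ltr_pdivrMr // ltr_pMr // ltr1n.
  by rewrite -subr_eq0 addrC addKr mulf_neq0 // gt_eqF // invr_gt0.
move=> U sU.
have : (s + t * (z - s)) @[t --> 0^'+] --> s.
  rewrite -[X in _ --> X]addr0 -[X in _ --> _ + X](mul0r (z - s)).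
  apply: cvgD; first exact: cvg_cst.
  by apply: cvgMl; apply: cvg_at_right_filter; exact: cvg_id.
move=> /(_ _ sU) /= nearU.
have [t [Ut t0 t1]] : exists t : R, [/\ U (s + t * (z - s)), 0 < t & t < 1].
  near (0 : R)^'+ => t; exists t; split; near: t => //.
  - exact: nbhs_right_gt.
  - exact: nbhs_right_lt.
exists (s + t * (z - s)); split => //.
  by rewrite -subr_eq0 addrC addKr mulf_neq0 ?subr_eq0 // gt_eqF.
have [zs'|zs'] := ltP z s.
- by apply: (itvI z s) => //; apply/andP; split; nra.
- by apply: (itvI s z) => //; apply/andP; split; nra.
Unshelve. all: by end_near. Qed.

(** A punctured two-sided limit is determined by the values along any set that
    accumulates at the point. *)
Lemma limit_point_cvg_eq0 I s (f : R -> R) l : limit_point I s ->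
  f h @[h --> 0^'] --> l -> (forall y, I y -> y != s -> f (y - s) = 0) -> l = 0.
Proof.
move=> sI fl f0; apply: contrapT => /eqP l0.
have /cvgrPdist_lt/(_ `|l|) := fl; rewrite normr_gt0 => /(_ l0) [e /= e0 he].
have [y [ys Iy /= sye]] := sI _ (nbhsx_ballx s e e0).
have := he (y - s); rewrite /ball_/= sub0r opprB subr_eq0 f0 // subr0 ltxx.
by move=> /(_ sye ys).
Qed.

Lemma limit_point_continuous_eq0 I s (f : R -> R) : limit_point I s ->
  {for s, continuous f} -> (forall y, I y -> y != s -> f y = 0) -> f s = 0.
Proof.
move=> sI fs f0; apply: (limit_point_cvg_eq0 (f := fun h => f (h + s)) sI).
  have shift_s : (h + s) @[h --> (0 : R)] --> s.
    rewrite -[X in _ --> X]add0r.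
    by apply: cvgD; [exact: cvg_id|exact: cvg_cst].
  by apply: cvg_within_filter; apply: cvg_comp shift_s fs.
by move=> y Iy ys; rewrite subrK f0.
Qed.

(** This is what allows identities valid on an interval to be differentiated at
    its endpoints with two-sided derivatives. *)
Lemma limit_point_derive_eq0 I s (f : R -> R) df : limit_point I s -> I s ->
  is_derive s 1 f df -> (forall y, I y -> f y = 0) -> df = 0.
Proof.
move=> sI Is [dfs <-] f0.
apply: (limit_point_cvg_eq0 sI dfs) => y Iy _ /=.
by rewrite [_%:A]mulr1 subrK !f0 // subrr scaler0.
Qed.

Lemma is_derive_mx m n (M : R -> 'M[R]_(m, n)) s (dM : 'M[R]_(m, n)) :
  (forall i j, is_derive s 1 (fun x => M x i j) (dM i j)) ->
  is_derive s 1 M dM.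
Proof.
move=> dMij; have Ms : derivable M s 1 by apply/derivable_mxP => i j; case: (dMij i j).
split=> //; rewrite derive_mx //; apply/matrixP => i j.
by rewrite mxE; exact: derive_val.
Qed.

Lemma is_derive_coord m n (M : R -> 'M[R]_(m, n)) s (dM : 'M[R]_(m, n)) i j :
  is_derive s 1 M dM -> is_derive s 1 (fun x => M x i j) (dM i j).
Proof.
case=> Ms <-; split; first by move/derivable_mxP : Ms.
by rewrite derive_mx // mxE.
Qed.

Lemma is_derive_dotv (u v : R -> 'rV[R]_3) s (du dv : 'rV[R]_3) :
  is_derive s 1 u du -> is_derive s 1 v dv ->
  is_derive s 1 (fun x => dotv (u x) (v x)) (dotv du (v s) + dotv (u s) dv).
Proof.
move=> us vs.
have prodi i : is_derive s 1 (fun x => u x 0 i * v x 0 i)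
    (u s 0 i * dv 0 i + v s 0 i * du 0 i).
  by apply: is_deriveM; exact: is_derive_coord.
have := is_derive_sum prodi; rewrite fct_sumE => /is_derive_eq; apply.
rewrite -big_split; apply: eq_bigr => i _.
by rewrite addrC [v s 0 i * _]mulrC.
Qed.

Lemma is_derive_crossv (u v : R -> 'rV[R]_3) s (du dv : 'rV[R]_3) :
  is_derive s 1 u du -> is_derive s 1 v dv ->
  is_derive s 1 (fun x => crossv (u x) (v x)) (crossv du (v s) + crossv (u s) dv).
Proof.
move=> us vs; apply: is_derive_mx => i j.
rewrite (ord1 i) => {i}; pose p k x := u x 0 (j + k); pose q k x := v x 0 (j + k).
rewrite (_ : (fun x => _) = p 1 * q 2%:R - p 2%:R * q 1); last first.
  by apply/funext => x; rewrite mxE.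
have dp k : is_derive s 1 (p k) (du 0 (j + k)) by exact: is_derive_coord.
have dq k : is_derive s 1 (q k) (dv 0 (j + k)) by exact: is_derive_coord.
apply: is_derive_eq; rewrite !mxE /p /q /GRing.scale /=; ring.
Qed.

Lemma is_derive_scale (k : R -> R) (v : R -> 'rV[R]_3) s dk (dv : 'rV[R]_3) :
  is_derive s 1 k dk -> is_derive s 1 v dv ->
  is_derive s 1 (fun x => k x *: v x) (dk *: v s + k s *: dv).
Proof.
move=> ks vs; apply: is_derive_mx => i j.
rewrite (_ : (fun x => _) = k * (fun x => v x i j)); last first.
  by apply/funext => x; rewrite mxE.
apply: is_derive_eq; first exact: is_deriveM ks (is_derive_coord i j vs).
by rewrite !mxE addrC [v s i j *: _]mulrC.
Qed.

Lemma derivable_enorm (u : R -> 'rV[R]_3) s du :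
  is_derive s 1 u du -> 0 < enorm (u s) -> derivable (fun x => enorm (u x)) s 1.
Proof.
rewrite /enorm sqrtr_gt0 => us us0.
have := is_derive1_comp (is_derive1_sqrt us0) (is_derive_dotv us us).
by case.
Qed.

(** The affine factor has at most one zero, and continuity recovers the value of
    F there from its vanishing at the other points. *)
Lemma affine_mul_eq0 I (F : R -> R) (a b : R) :
  (forall s, I s -> limit_point I s) ->
  (forall s, I s -> {for s, continuous F}) -> (a != 0 \/ b != 0) ->
  (forall s, I s -> (a * s + b) * F s = 0) -> forall s, I s -> F s = 0.
Proof.
move=> limI Fc ab abF s Is.
have [ab_s|ab_s] := eqVneq (a * s + b) 0; last first.
  by have /eqP := abF s Is; rewrite mulf_eq0 (negbTE ab_s) => /eqP.
apply: (limit_point_continuous_eq0 (limI s Is) (Fc s Is)) => y Iy ys.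
have /eqP := abF y Iy; rewrite mulf_eq0 => /orP[/eqP ab_y|/eqP //].
have /eqP : a * (y - s) = 0 by rewrite mulrBr; lra.
rewrite mulf_eq0 subr_eq0 (negbTE ys) orbF => /eqP a0.
by case: ab; rewrite ?a0 ?eqxx // => /eqP []; rewrite -ab_s a0 mul0r add0r.
Qed.

End Calculus.

(** * The Frenet frame along the interval *)

Section Frenet.
Variables (R : realType) (I : set R) (alpha : R -> 'rV[R]_3).
Hypotheses (alpha_smooth : smooth_on I alpha) (alpha_unit : unit_speed I alpha).
Hypothesis kappa_gt0 : forall s, I s -> 0 < curvature alpha s.
Implicit Type s : R.

Lemma is_derive_smooth n s : I s ->
  is_derive s 1 (derive1n n alpha) (derive1n n.+1 alpha s).
Proof.
move=> Is; case: alpha_smooth => U [_ IU Ualpha].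
by split; [exact: Ualpha (IU s Is)|rewrite derive1nS derive1E].
Qed.

Lemma curvature_derivable s : I s -> derivable (curvature alpha) s 1.
Proof. by move=> Is; exact: derivable_enorm (is_derive_smooth 2 Is) (kappa_gt0 Is). Qed.

Lemma binormalE : binormal alpha =
  (fun s => (curvature alpha s)^-1 *: crossv (derive1n 1 alpha s) (derive1n 2 alpha s)).
Proof. by apply/funext => s; rewrite /binormal crossvZr. Qed.

(** The product rule applied to B = kappa^-1 (T x T').  The coefficient m is the
    derivative of kappa^-1; it can stay unspecified because T x T' is orthogonal
    to the normal, so that m does not affect the torsion. *)
Lemma is_derive_binormal s : I s -> exists m,
  is_derive s 1 (binormal alpha)
    (m *: crossv (derive1n 1 alpha s) (derive1n 2 alpha s) +
     (curvature alpha s)^-1 *: crossv (derive1n 1 alpha s) (derive1n 3 alpha s)).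
Proof.
move=> Is; rewrite binormalE; eexists.
apply: is_derive_eq.
  apply: is_derive_scale.
    apply: is_deriveV; first by rewrite gt_eqF // kappa_gt0.
    exact: derivableP (curvature_derivable Is).
  exact: is_derive_crossv (is_derive_smooth 1 Is) (is_derive_smooth 2 Is).
by rewrite crossvv add0r.
Qed.

(** The classical det(T, T', T'') / kappa^2: it trades the derivative of the
    binormal for derivatives of the curve, whose continuity is known. *)
Lemma torsionE s : I s -> torsion alpha s = (curvature alpha s) ^- 2 *
  dotv (crossv (derive1n 1 alpha s) (derive1n 2 alpha s)) (derive1n 3 alpha s).
Proof.
move=> Is; have [m [_ dBE]] := is_derive_binormal Is.
rewrite /torsion derive1E dBE /normal -[derive1 (tangent alpha) s]/(derive1n 2 alpha s).
move: (derive1n 1 _ _) (derive1n 2 _ _) (derive1n 3 _ _) => T A J.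
rewrite dotvZr dotvC dotvDr !dotvZr (dotvC A) dotv_crossv.
rewrite (dotvC A) dotv_crossvCA.
by rewrite mulr0 add0r !mulrN opprK mulrA -invfM -expr2.
Qed.

Lemma dotv_tangent s : I s -> dotv (tangent alpha s) (tangent alpha s) = 1.
Proof. by move=> Is; rewrite -enorm_sqr alpha_unit // expr1n. Qed.

(** Half the derivative of T . T - 1, which vanishes on I. *)
Lemma dotv_tangent_acceleration s : limit_point I s -> I s ->
  dotv (tangent alpha s) (derive1n 2 alpha s) = 0.
Proof.
move=> limI Is; have dT := is_derive_smooth 1 Is.
have dTT := is_derive_dotv dT dT.
have dTT1 := is_deriveB dTT (is_derive_cst (1 : R) s 1).
have := limit_point_derive_eq0 limI Is dTT1.
rewrite subr0 dotvC -mulr2n => /(_ _)/eqP; rewrite mulrn_eq0 => /(_ _)/eqP; apply.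
move=> y Iy; rewrite -[LHS]/(dotv (tangent alpha y) (tangent alpha y) - 1).
by rewrite dotv_tangent // subrr.
Qed.

(** The triple product is (T x X) . X'.  Since T x (T x T') = - T', the first
    factor is - (c s + d) N, which selects the normal component of X'. *)
Lemma det3_ruling a b c d s : limit_point I s -> I s ->
  let X x := (a * x + b) *: tangent alpha x + (c * x + d) *: binormal alpha x in
  det3 (tangent alpha s) (X s) (derive1 X s) =
  - ((c * s + d) *
     ((a * s + b) * curvature alpha s - (c * s + d) * torsion alpha s)).
Proof.
move=> limI Is X; have k0 := kappa_gt0 Is.
have dB : is_derive s 1 (binormal alpha) (derive1 (binormal alpha) s).
  by have [m [dB _]] := is_derive_binormal Is; rewrite derive1E; exact: derivableP.
have daff p q : is_derive s 1 (fun x : R => p * x + q) p.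
  by apply: is_derive_eq; rewrite addr0; exact: mulr1.
have dX := is_deriveD (is_derive_scale (daff a b) (is_derive_smooth 1 Is))
  (is_derive_scale (daff c d) dB).
have {dX} -> : derive1 X s = a *: tangent alpha s + (a * s + b) *: derive1n 2 alpha s
    + (c *: binormal alpha s + (c * s + d) *: derive1 (binormal alpha) s).
  by rewrite derive1E; case: dX.
have TT := dotv_tangent Is.
have TA := dotv_tangent_acceleration limI Is.
have AA : dotv (derive1n 2 alpha s) (derive1n 2 alpha s) = curvature alpha s ^+ 2.
  by rewrite -enorm_sqr.
have BE : binormal alpha s =
    (curvature alpha s)^-1 *: crossv (tangent alpha s) (derive1n 2 alpha s).
  by rewrite binormalE.
have tauE : torsion alpha s = - ((curvature alpha s)^-1 *
    dotv (derive1 (binormal alpha) s) (derive1n 2 alpha s)).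
  by rewrite /torsion dotvZr.
rewrite det3E /X tauE BE crossvDr !crossvZr crossvv crossv_crossv TT TA.
move: (derive1 (binormal alpha) s) => B'.
rewrite scaler0 add0r scale0r add0r scale1r.
rewrite -scaleN1r !dotvZl !dotvDr !dotvZr AA.
rewrite (dotvC _ (tangent _ _)) TA (dotvC _ (crossv _ _)) dotv_crossv (dotvC B').
by field; rewrite gt_eqF.
Qed.

End Frenet.

(** * Developability and the curvature-torsion ratio *)

Theorem theorem9 (R : realType) (I : set R) (alpha : R -> 'rV[R]_3)
    (a b c d : R)
    (I_interval : is_interval I) (I_nondegenerate : I° !=set0)
    (alpha_smooth : smooth_on I alpha) (alpha_unit : unit_speed I alpha)
    (kappa_gt0 : forall s, I s -> 0 < curvature alpha s)
    (ab_neq0 : a != 0 \/ b != 0) (cd_neq0 : c != 0 \/ d != 0) :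
  let Phi := RuledSurface alpha (fun s =>
    (a * s + b) *: tangent alpha s + (c * s + d) *: binormal alpha s) in
  developable I Phi <->
  generalized_euler_spiral I alpha /\
  curvature_torsion_ratio I alpha c d a b.
Proof.
move=> Phi.
have limI s (Is : I s) := interval_limit_point I_interval I_nondegenerate Is.
pose tau s := (curvature alpha s) ^- 2 *
  dotv (crossv (derive1n 1 alpha s) (derive1n 2 alpha s)) (derive1n 3 alpha s).
pose D s := (a * s + b) * curvature alpha s - (c * s + d) * tau s.
have tauE s : I s -> torsion alpha s = tau s by exact: torsionE.
have D_continuous s : I s -> {for s, continuous D}.
  move=> Is.
  have cts (f : R -> R) df : is_derive s 1 f df -> f x @[x --> s] --> f s.
    by case=> /derivable1_diffP /differentiable_continuous.
  have affc p q : p * x + q @[x --> s] --> p * s + q.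
    by apply: cvgD; [apply: cvgMr; exact: cvg_id|exact: cvg_cst].
  have kc := cts _ _ (derivableP (curvature_derivable alpha_smooth kappa_gt0 Is)).
  have dJ n := is_derive_smooth alpha_smooth n Is.
  have tauc := cts _ _ (is_derive_dotv (is_derive_crossv (dJ 1) (dJ 2)) (dJ 3)).
  apply: cvgB; apply: cvgM => //; apply: cvgM => //.
  by apply: cvgV; [rewrite expf_neq0 // gt_eqF // kappa_gt0|exact: cvgM].
have detE s : I s -> det3 (derive1 (base_curve Phi) s) (director Phi s)
    (derive1 (director Phi) s) = - ((c * s + d) * D s).
  move=> Is; rewrite /D -tauE //.
  exact: det3_ruling alpha_smooth alpha_unit kappa_gt0 a b c d _ (limI s Is) Is.
have developableE : developable I Phi <-> forall s, I s -> D s = 0.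
  split=> [dev|D0 s Is].
    apply: (affine_mul_eq0 limI D_continuous cd_neq0) => s Is.
    by have /eqP := dev s Is; rewrite detE // oppr_eq0 => /eqP.
  by rewrite detE // D0 // mulr0 oppr0.
have ratioE : curvature_torsion_ratio I alpha c d a b <->
    forall s, I s -> D s = 0.
  split=> [[_ ratio]|D0].
    apply: (affine_mul_eq0 limI D_continuous ab_neq0) => s Is.
    have [->|ab_s] := eqVneq (a * s + b) 0; first by rewrite mul0r.
    have [tau0 /eqP] := ratio s Is ab_s.
    rewrite eqr_div // tauE // => /eqP kappa_ab.
    by rewrite /D [_ * curvature _ _]mulrC kappa_ab subrr mulr0.
  split=> // s Is ab_s; have /eqP := D0 s Is; rewrite subr_eq0 -tauE // => /eqP D0s.
  have tau0 : torsion alpha s != 0.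
    apply/eqP => tau0; have /eqP := D0s.
    by rewrite tau0 mulr0 mulf_eq0 (negbTE ab_s) gt_eqF // kappa_gt0.
  by split=> //; apply/eqP; rewrite eqr_div // mulrC D0s.
rewrite developableE -ratioE.
by split=> [ratio|[]//]; split=> //; exists c, d, a, b.
Qed.
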